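(* Let $(A_S,S)$ be an Artin–Tits system of spherical type, let $G=gA_Xg^{-1}$ (with $g\in A_S$, $X\subset S$) be a parabolic subgroup of $A_S$ and let $Y\subset S$. If $G\subset A_Y$ then $G$ is a parabolic subgroup of $A_Y$; that is, $$gA_Xg^{-1}\subset A_Y\ \Longrightarrow\ \exists R\subset Y,\ \exists y\in A_Y \text{ such that } gA_Xg^{-1}=yA_Ry^{-1}.$$
   Context: Let $S$ be a finite set and $M=(m_{s,t})_{s,t\in S}$ a symmetric matrix with $m_{s,s}=1$ and $m_{s,t}\in\{2,3,\dots\}\cup\{\infty\}$ for $s\neq t$. The associated Artin–Tits system is $(A_S,S)$, where $A_S$ is the group with generators $S$ and relations $\underbrace{sts\cdots}_{m_{s,t}}=\underbrace{tst\cdots}_{m_{s,t}}$ for all $s\ne t$ in $S$ with $m_{s,t}\neq\infty$. The associated Coxeter group $W_S$ is obtained by adding the relations $s^2=1$, $s\in S$. One says that $A_S$ is of spherical type if $W_S$ is finite. For $X\subset S$, $A_X$ is the subgroup of $A_S$ generated by $X$, called a standard parabolic subgroup; $(A_X,X)$ is canonically isomorphic to the Artin–Tits system associated to $(m_{s,t})_{s,t\in X}$. A parabolic subgroup of $A_S$ is a subgroup conjugate in $A_S$ to a standard parabolic subgroup. *)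

(* Defs.v *)
From HB Require Import structures.
From mathcomp Require Import all_boot.
From mathcomp Require Import boolp classical_sets cardinality.

Set Implicit Arguments.
Unset Strict Implicit.
Unset Printing Implicit Defensive.

Local Open Scope classical_set_scope.
Local Open Scope group_scope.

(* A group word over [S]; the letter [(s, true)] is the generator [s] and
   [(s, false)] is its inverse. *)
Definition word (S : Type) := seq (S * bool).

Definition inv_word (S : Type) (u : word S) : word S :=
  rev [seq (a.1, ~~ a.2) | a <- u].

Section Presentation.
Variables (S : choiceType) (r : word S -> word S -> Prop).

Inductive word_eq : word S -> word S -> Prop :=
| WordEqRel u v of r u v : word_eq u v
| WordEqCancel s b : word_eq [:: (s, b); (s, ~~ b)] [::]
| WordEqRefl u : word_eq u u
| WordEqSym u v of word_eq u v : word_eq v u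
| WordEqTrans u v w of word_eq u v & word_eq v w : word_eq u w
| WordEqCat u u' v v' of word_eq u u' & word_eq v v' :
    word_eq (u ++ v) (u' ++ v').

Definition word_eqb (u v : word S) : bool := `[< word_eq u v >].

Fact word_eqb_refl : reflexive word_eqb.
Proof. by move=> u; apply/asboolP/WordEqRefl. Qed.

Fact word_eqb_sym : symmetric word_eqb.
Proof. by move=> u v; apply/asboolP/asboolP; apply: WordEqSym. Qed.

Fact word_eqb_trans : transitive word_eqb.
Proof.
by move=> v u w /asboolP uv /asboolP vw; apply/asboolP/(WordEqTrans uv vw).
Qed.

Canonical word_equiv :=
  EquivRel word_eqb word_eqb_refl word_eqb_sym word_eqb_trans.

(* The group with generators [S] and relations [u = v] for [r u v]. *)
Definition presented_group := {eq_quot word_equiv}%qT.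

HB.instance Definition _ := Choice.on presented_group.
HB.instance Definition _ := EqQuotient.on presented_group.

Definition class_of_word (u : word S) : presented_group :=
  \pi_presented_group%qT u.

Lemma class_of_wordP u v : class_of_word u = class_of_word v <-> word_eq u v.
Proof. by split=> [/eqmodP/asboolP|uv]; last apply/eqmodP/asboolP. Qed.

Lemma class_of_wordK x : class_of_word (repr x) = x.
Proof. exact: reprK. Qed.

Lemma word_eq_repr u : word_eq (repr (class_of_word u)) u.
Proof. by apply/class_of_wordP; rewrite class_of_wordK. Qed.

Definition pres_one : presented_group := class_of_word [::].
Definition pres_mul (x y : presented_group) : presented_group :=
  class_of_word (repr x ++ repr y).
Definition pres_inv (x : presented_group) : presented_group :=
  class_of_word (inv_word (repr x)).

Lemma pres_mulE u v :
  pres_mul (class_of_word u) (class_of_word v) = class_of_word (u ++ v).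
Proof. by apply/class_of_wordP/WordEqCat; apply: word_eq_repr. Qed.

Lemma inv_wordK : involutive (@inv_word S).
Proof.
move=> u; rewrite /inv_word map_rev revK -map_comp.
by apply: map_id_in => -[s b] _ /=; rewrite negbK.
Qed.

Lemma cat_inv_word u : word_eq (u ++ inv_word u) [::].
Proof.
elim: u => [|[s b] u IHu]; first exact: WordEqRefl.
rewrite /inv_word /= rev_cons -cats1 -cat_cons catA.
apply: WordEqTrans (WordEqCancel s b).
rewrite -[[:: _; _]]/([:: (s, b)] ++ [:: (s, ~~ b)]).
apply: WordEqCat; last exact: WordEqRefl.
exact: (WordEqCat (WordEqRefl [:: (s, b)]) IHu).
Qed.

Fact pres_mulA : associative pres_mul.
Proof.
move=> x y z; rewrite -[x]class_of_wordK -[y]class_of_wordK.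
by rewrite -[z]class_of_wordK !pres_mulE catA.
Qed.

Fact pres_mul1 : left_id pres_one pres_mul.
Proof. by move=> x; rewrite -[x]class_of_wordK pres_mulE. Qed.

Fact pres_mulr1 : right_id pres_one pres_mul.
Proof. by move=> x; rewrite -[x]class_of_wordK pres_mulE cats0. Qed.

Fact pres_mulV : left_inverse pres_one pres_inv pres_mul.
Proof.
move=> x; rewrite -[in X in pres_mul _ X](class_of_wordK x) pres_mulE.
apply/class_of_wordP; rewrite -[X in _ ++ X]inv_wordK; exact: cat_inv_word.
Qed.

Fact pres_mulrV : right_inverse pres_one pres_inv pres_mul.
Proof.
move=> x; rewrite -[in X in pres_mul X _](class_of_wordK x) pres_mulE.
exact/class_of_wordP/cat_inv_word.
Qed.

HB.instance Definition _ := isGroup.Build presented_group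
  pres_mulA pres_mul1 pres_mulr1 pres_mulV pres_mulrV.

Definition pres_gen (s : S) : presented_group := class_of_word [:: (s, true)].

End Presentation.

(* [None] stands for the value [infinity]. *)
Record coxeter_matrix (S : finType) := CoxeterMatrix {
  coxeter_entry :> S -> S -> option nat;
  coxeter_diag : forall s, coxeter_entry s s = Some 1%N;
  coxeter_sym : forall s t, coxeter_entry s t = coxeter_entry t s;
  coxeter_ge2 : forall s t k,
    s != t -> coxeter_entry s t = Some k -> (2 <= k)%N
}.

Section ArtinTits.
Variables (S : finType) (m : coxeter_matrix S).

(* The word [s t s ...] with [k] letters. *)
Definition alt_word (k : nat) (s t : S) : word S :=
  mkseq (fun i => (if odd i then t else s, true)) k.

Inductive artin_rel : word S -> word S -> Prop :=
| ArtinRel s t k of s != t & m s t = Some k :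
    artin_rel (alt_word k s t) (alt_word k t s).

Inductive coxeter_rel : word S -> word S -> Prop :=
| CoxeterBraid u v of artin_rel u v : coxeter_rel u v
| CoxeterSquare s : coxeter_rel [:: (s, true); (s, true)] [::].

Definition artin_group : groupType := presented_group artin_rel.
Definition coxeter_group : groupType := presented_group coxeter_rel.

Definition spherical : Prop := finite_set [set: coxeter_group].

Definition artin_gen (s : S) : artin_group := pres_gen artin_rel s.

End ArtinTits.

Definition is_subgroup (G : groupType) (H : set G) : Prop :=
  [/\ H 1, forall x y, H x -> H y -> H (x * y) & forall x, H x -> H x^-1].

Definition generated_subgroup (G : groupType) (A : set G) : set G :=
  smallest (@is_subgroup G) A.

(* [x H x^-1]; the library's [h ^ x] is [x^-1 * h * x]. *)
Definition conj_set (G : groupType) (x : G) (H : set G) : set G :=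
  [set x * h * x^-1 | h in H].

Definition std_parabolic (S : finType) (m : coxeter_matrix S) (X : {set S}) :
    set (artin_group m) :=
  generated_subgroup (@artin_gen S m @` [set` X]).

Arguments std_parabolic {S} m X.

(* Main.v *)
Require Import Defs.
From mathcomp Require Import all_boot.
From mathcomp Require Import ssralg ssrnum algC cyclotomic poly ring.
From mathcomp Require Import boolp classical_sets cardinality.

(** The Artin group [A] acts on the right on the cosets [W_Y \ W] of the Coxeter
    group [W].  Represent each coset by its shortest element [w].  A generator
    [s] either moves the coset, and then [w s] is the new representative, or
    fixes it, and then [w s = x w] for a simple reflection [x] of [Y]
    ([reduced_step]).  Recording the letters [x] as elements of [A_Y] lifts the
    action to pairs [(a, w)] ([state_step]): a labelled step multiplies [a] on
    the right by the generator [x].  This commutes with multiplication of [a]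
    on the left, and the walk of an element of [A_Y] from [(1, 1)] spells that
    element ([act_std_parabolic]), so that the first component of the walk from
    [(1, 1)] is a retraction of [A] onto [A_Y], as a map of sets.

    Now let [g s g^-1] belong to [A_Y] for all [s] in [X], and let [g] lead from
    [(1, 1)] to [(y, w)].  Comparing two ways of walking along
    [(g s g^-1) g = g s] shows that [s] fixes the coset of [w], with a label
    [f s] in [Y], and that [g s g^-1 = y (f s) y^-1] ([retraction_conj]).  Hence
    [g A_X g^-1 = y A_R y^-1] with [R = f X], and [y] is in [A_Y] because labels
    are.

    The work lies in the braid relations ([state_walk_braid]).  By Kilmoyer's
    argument the dihedral subgroup [W_{s,t}] meets [w^-1 W_Y w] in everything or
    in at most one nontrivial element ([dihedral_stabilizerP]).  In the first
    case the labels [x], [y] of [s], [t] are simple reflections whose product is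
    conjugate to [s t], so they satisfy the same braid relation
    ([coxeter_entry_conj]); this uses the geometric representation, which
    computes the order of [s t].  In the second case only the number of
    crossings of one wall matters, and both sides of the braid relation cross
    the same walls.  Coxeter combinatorics enters through the inversion
    cocycle, whose invariance ([odd_count_refls]) gives the strong exchange
    property. *)

Set Implicit Arguments.
Unset Strict Implicit.
Unset Printing Implicit Defensive.

Local Open Scope classical_set_scope.
Local Open Scope group_scope.

(** * Generated subgroups and conjugation *)

Section Subgroups.
Variable G : groupType.
Implicit Types (H K B : set G).

Lemma sub_generated B : B `<=` generated_subgroup B.
Proof. exact: sub_gen_smallest. Qed.

Lemma generated_min B H : is_subgroup H -> B `<=` H -> generated_subgroup B `<=` H.
Proof. exact: smallest_sub. Qed.

Lemma generated_is_subgroup B : is_subgroup (generated_subgroup B).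
Proof.
split=> [H [[]] //|x y Bx By H BH|x Bx H BH].
  by have [[_ HM _] _] := BH; apply: HM; [apply: Bx | apply: By].
by have [[_ _ HV] _] := BH; apply: HV; apply: Bx.
Qed.

Lemma conj_set_is_subgroup x H : is_subgroup H -> is_subgroup (conj_set x H).
Proof.
case=> H1 HM HV; split.
- by exists 1; rewrite // mulg1 mulgV.
- move=> _ _ [h Hh <-] [k Hk <-]; exists (h * k); first exact: HM.
  by rewrite !mulgA mulgVK.
- by move=> _ [h Hh <-]; exists h^-1; [apply: HV | rewrite !invgM invgK mulgA].
Qed.

Lemma conj_generated_sub x B H : is_subgroup H -> conj_set x B `<=` H ->
  conj_set x (generated_subgroup B) `<=` H.
Proof.
move=> Hg BH _ [h Bh <-].
have : conj_set x^-1 H h.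
  apply: generated_min Bh; first exact: conj_set_is_subgroup.
  move=> b Bb; exists (x * b * x^-1); first by apply: BH; exists b.
  by rewrite invgK !mulgA mulVg mul1g mulgVK.
by case=> k Hk <-; rewrite invgK !mulgA mulgV mul1g mulgK.
Qed.

Lemma conj_generated_eq x y B C : conj_set x B = conj_set y C ->
  conj_set x (generated_subgroup B) = conj_set y (generated_subgroup C).
Proof.
move=> BC; apply/seteqP; split; apply: conj_generated_sub.
1,3: exact/conj_set_is_subgroup/generated_is_subgroup.
1: rewrite BC. 2: rewrite -BC.
all: by move=> _ [z Bz <-]; exists z => //; apply: sub_generated.
Qed.

End Subgroups.

(** * Words acting on states *)

Section Walk.
Variables (S T : Type) (f : S * bool -> T -> T).

Definition walk (u : word S) (x : T) : T := foldl (fun y a => f a y) x u.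

Lemma walk_cat u v x : walk (u ++ v) x = walk v (walk u x).
Proof. exact: foldl_cat. Qed.

Lemma walk_inv (P : T -> Prop) :
  (forall a x, P x -> P (f a x)) -> forall u x, P x -> P (walk u x).
Proof. by move=> stepP; elim=> //= a u IHu x Px; apply/IHu/stepP. Qed.

End Walk.

(** This is how a presented group is made to act: on the states satisfying an
    invariant [P], it suffices that opposite letters undo each other and that
    both sides of each defining relation act alike.  The invariant matters:
    for the action on labelled states below, the braid relations hold only at
    reduced elements. *)
Lemma walk_word_eq (S : choiceType) (r : word S -> word S -> Prop) (T : Type)
    (f : S * bool -> T -> T) (P : T -> Prop) :
  (forall a x, P x -> P (f a x)) ->
  (forall s b x, P x -> f (s, ~~ b) (f (s, b) x) = x) ->
  (forall u v x, r u v -> P x -> walk f u x = walk f v x) ->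
  forall u v x, word_eq r u v -> P x -> walk f u x = walk f v x.
Proof.
move=> fP fK fr u v x uv; elim: uv x => {u v}.
- by move=> u v uv x; apply: fr.
- by move=> s b x Px; apply: fK.
- by [].
- by move=> u v _ IH x /IH.
- by move=> u v w _ IHu _ IHv x Px; rewrite IHu ?IHv.
- move=> u u' v v' _ IHu _ IHv x Px.
  by rewrite !walk_cat IHu ?IHv //; apply: walk_inv.
Qed.

Lemma alt_wordS (S : finType) k (s t : S) :
  alt_word k.+1 s t = (s, true) :: alt_word k t s.
Proof.
rewrite /alt_word /mkseq /= -[1%N]addn0 iotaDl -map_comp; congr (_ :: _).
by apply: eq_map => i /=; case: (odd i).
Qed.

(** When [s] and [t] act by involutions, [s t s ... = (s t)^k (t s t ...)],
    both alternating words having [k] letters. *)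
Lemma walk_alt_word (S : finType) (T : Type) (f : S * bool -> T -> T) (s t : S)
    k x :
  involutive (f (s, true)) -> involutive (f (t, true)) ->
  walk f (alt_word k s t) x =
    walk f (alt_word k t s) (iter k (f (t, true) \o f (s, true)) x).
Proof.
elim: k s t x => [//|k IHk] s t x sK tK.
rewrite !alt_wordS /= IHk //; congr (walk _ _ _).
rewrite /comp /= tK; elim: k {IHk} => //= k ->; by [].
Qed.

Section PresentedGroup.
Variables (S : choiceType) (r : word S -> word S -> Prop).
Local Notation cl := (class_of_word r).

Lemma class_cat u v : cl (u ++ v) = cl u * cl v.
Proof. by rewrite -pres_mulE. Qed.

Lemma class_nil : cl [::] = 1.
Proof. by []. Qed.

Lemma class_letter s b :
  cl [:: (s, b)] = if b then pres_gen r s else (pres_gen r s)^-1.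
Proof.
case: b => //; apply/esym/mulg1_eq; rewrite /pres_gen -class_cat.
exact/class_of_wordP/(WordEqCancel _ s true).
Qed.

Lemma class_cons a u : cl (a :: u) = cl [:: a] * cl u.
Proof. by rewrite -class_cat. Qed.

End PresentedGroup.

(** * The order of a product of two simple reflections *)

Section Geometric.
Variables (S : finType) (m : coxeter_matrix S).
Local Open Scope ring_scope.
Import GRing.Theory Num.Theory.

(** Plays the part of [exp(i pi / k)], so that [- geo_form s t] is
    [2 cos(pi / k)] up to the choice of the primitive root; for [k = infinity]
    any nonzero number that is not a root of unity would do. *)
Definition half_angle (k : option nat) : algC :=
  if k is Some n.+1 then sval (C_prim_root_exists (n:=(2 * n.+1)%N) isT) else 2.

Definition geo_form (s t : S) : algC :=
  if s == t then 2 else - (half_angle (m s t) + (half_angle (m s t))^-1).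

(** The dual of the geometric representation: a functional is recorded by its
    values on the simple roots. *)
Definition geo_step (a : S * bool) (f : S -> algC) : S -> algC :=
  fun u => f u - geo_form a.1 u * f a.1.

Lemma geo_stepK a : involutive (geo_step a).
Proof.
move=> f; apply/funext => u; rewrite /geo_step /geo_form eqxx; ring.
Qed.

Lemma geo_form_sym s t : geo_form s t = geo_form t s.
Proof. by rewrite /geo_form eq_sym coxeter_sym. Qed.

Section Dihedral.
Variables s t : S.
Hypothesis st : s != t.
Let h := half_angle (m s t).
Let rot := geo_step (t, true) \o geo_step (s, true).

Lemma half_angle_neq0 k : half_angle k != 0.
Proof.
case: k => [[|n]|] /=; rewrite ?pnatr_eq0 //.
case: C_prim_root_exists => z /= zprim; apply/eqP => z0.
by move/eqP: (prim_expr_order zprim); rewrite z0 expr0n eq_sym oner_eq0.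
Qed.

Let h0 : h != 0 := half_angle_neq0 (m s t).

Lemma geo_rot_s f : rot f s = (h + h^-1) * f t + ((h + h^-1) ^+ 2 - 1) * f s.
Proof.
rewrite /rot /= /geo_step /= [geo_form t s]geo_form_sym.
rewrite /geo_form eqxx (negPf st) -/h.
ring.
Qed.

Lemma geo_rot_t f : rot f t = - (f t + (h + h^-1) * f s).
Proof.
rewrite /rot /= /geo_step /= /geo_form eqxx (negPf st) -/h.
ring.
Qed.

(** On the plane of the values at [s] and [t] the rotation has the eigenvalues
    [h ^+ 2] and [h ^- 2], with the eigenforms [h f(s) + f(t)] and
    [h^-1 f(s) + f(t)]. *)
Lemma geo_rot_eigen f n :
  h * iter n rot f s + iter n rot f t = (h ^+ 2) ^+ n * (h * f s + f t).
Proof.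
elim: n => [|n IHn]; first by rewrite expr0 mul1r.
rewrite exprS -[RHS]mulrA.
rewrite -IHn /= geo_rot_s geo_rot_t; field; exact: h0.
Qed.

Lemma geo_rot_eigenV f n :
  h^-1 * iter n rot f s + iter n rot f t = (h ^- 2) ^+ n * (h^-1 * f s + f t).
Proof.
elim: n => [|n IHn]; first by rewrite expr0 mul1r.
rewrite exprS -[RHS]mulrA.
rewrite -IHn /= geo_rot_s geo_rot_t; field; exact: h0.
Qed.

(** The value at any simple root changes by multiples of the values at [s] and
    [t] met on the way, which are summed separately for the two letters. *)
Lemma geo_rot_sum f n u :
  iter n rot f u = f u
    - geo_form s u * (\sum_(j < n) iter j rot f s)
    - geo_form t u *
      (\sum_(j < n) (iter j rot f t + (h + h^-1) * iter j rot f s)).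
Proof.
elim: n => [|n IHn]; first by rewrite !big_ord0 !mulr0 !subr0.
rewrite !big_ord_recr /= {1}/rot /= /geo_step /= IHn.
rewrite [geo_form s t]/geo_form (negPf st) -/h; ring.
Qed.

(** The braid relation holds because the values met during a full turn are
    combinations of geometric progressions whose ratios are [k]-th roots of
    unity other than 1, and hence sum to 0. *)
Lemma geo_rot_order k f : m s t = Some k -> iter k rot f = f.
Proof.
move=> mst; have k2 : (2 <= k)%N := coxeter_ge2 st mst.
have hprim : (2 * k)%N.-primitive_root h.
  rewrite /h mst; case: k k2 {mst} => // k _ /=. by case: C_prim_root_exists.
have h2k : (h ^+ 2) ^+ k = 1 by rewrite -exprM prim_expr_order.
have h2 : h ^+ 2 - 1 != 0.
  rewrite subr_eq0 -(prim_order_dvd hprim).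
  apply/negP => /dvdn_leq -/(_ isT); case: (k) k2 => [|[|n]] // _.
  by rewrite mulnC.
have sumS (x c : algC) :
    x ^+ k = 1 -> x - 1 != 0 -> \sum_(j < k) x ^+ j * c = 0.
  move=> xk x1; rewrite -mulr_suml; apply/eqP.
  rewrite mulf_eq0; apply/orP; left.
  by have /eqP := subrX1 x k; rewrite xk subrr eq_sym mulf_eq0 (negPf x1).
have s1 : h * (\sum_(j < k) iter j rot f s) + (\sum_(j < k) iter j rot f t) = 0.
  rewrite mulr_sumr -big_split /=
    (eq_bigr _ (fun (j : 'I_k) _ => geo_rot_eigen f j)).
  exact: sumS.
have s2 :
    h^-1 * (\sum_(j < k) iter j rot f s) + (\sum_(j < k) iter j rot f t) = 0.
  rewrite mulr_sumr -big_split /=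
    (eq_bigr _ (fun (j : 'I_k) _ => geo_rot_eigenV f j)).
  apply: sumS; first by rewrite exprVn h2k invr1.
  rewrite (_ : _ - _ = - (h ^- 2) * (h ^+ 2 - 1)); last by field; exact: h0.
  by rewrite mulf_neq0 // oppr_eq0 invr_eq0 expf_neq0.
have ss : \sum_(j < k) iter j rot f s = 0.
  move: s1 s2; set x := \sum_(j < k) _; set y := \sum_(j < k) _ => s1 s2.
  have /eqP : (h - h^-1) * x = 0.
    by transitivity ((h * x + y) - (h^-1 * x + y)); [ring | rewrite s1 s2 subrr].
  rewrite mulf_eq0 => /orP[|/eqP //].
  rewrite (_ : h - h^-1 = h^-1 * (h ^+ 2 - 1)); last by field; exact: h0.
  by rewrite mulf_eq0 (negPf h2) invr_eq0 (negPf h0).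
have st0 : \sum_(j < k) iter j rot f t = 0 by rewrite ss mulr0 add0r in s1.
apply/funext => u; rewrite geo_rot_sum ss big_split /= -mulr_sumr ss st0.
by rewrite !mulr0 addr0 mulr0 !subr0.
Qed.

(** Conversely the eigenvalue [h ^+ 2] has order exactly [m s t]. *)
Lemma geo_rot_faithful n : (0 < n)%N -> iter n rot =1 id ->
  exists2 k, m s t = Some k & (k %| n)%N.
Proof.
move=> n0 rot1; pose f u : algC := (u == t)%:R.
have hn : (h ^+ 2) ^+ n = 1.
  have := geo_rot_eigen f n; rewrite rot1 /f (negPf st) eqxx mulr0 add0r mulr1.
  by move<-.
move: hn; rewrite /h; case mst: (m s t) => [k|] /=.
  have k2 : (2 <= k)%N := coxeter_ge2 st mst.
  case: k k2 mst => // k _ mst; case: C_prim_root_exists => z /= zprim.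
  rewrite -exprM => /eqP; rewrite -(prim_order_dvd zprim) dvdn_pmul2l // => kn.
  by exists k.+1.
move/eqP; rewrite -exprM -natrX pnatr_eq1 -(expn0 2) eqn_exp2l //.
by rewrite muln_eq0 /= (gtn_eqF n0).
Qed.

End Dihedral.
End Geometric.

(** * Simple reflections *)

Section Coxeter.
Variables (S : finType) (m : coxeter_matrix S).
Local Notation W := (coxeter_group m).
Local Notation wd := (class_of_word (coxeter_rel m)).

Definition simple_refl (s : S) : W := pres_gen (coxeter_rel m) s.
Local Notation sg := simple_refl.

Lemma simple_refl2 s : sg s * sg s = 1.
Proof.
rewrite /sg /pres_gen -class_cat; apply/class_of_wordP/WordEqRel.
exact: CoxeterSquare.
Qed.

Lemma simple_reflV s : (sg s)^-1 = sg s.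
Proof. exact/mulg1_eq/simple_refl2. Qed.

Lemma class_letterE a : wd [:: a] = sg a.1.
Proof. by case: a => s b; rewrite class_letter; case: b; rewrite ?simple_reflV. Qed.

Lemma class_consE a u : wd (a :: u) = sg a.1 * wd u.
Proof. by rewrite class_cons class_letterE. Qed.

Lemma class_alt_word k s t :
  wd (alt_word k s t) = (sg s * sg t) ^+ k * wd (alt_word k t s).
Proof.
pose f (a : S * bool) (w : W) := w * sg a.1.
have walkE u w : walk f u w = w * wd u.
  by elim: u w => [|a u IHu] w /=; rewrite ?mulg1 // IHu class_consE mulgA.
have fK a : involutive (f a) by move=> w; rewrite /f -mulgA simple_refl2 mulg1.
have := walk_alt_word k 1 (fK (s, true)) (fK (t, true)).
rewrite !walkE mul1g => ->; congr (_ * _).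
by elim: k => //= k ->; rewrite expgSr /f /= mulgA.
Qed.

Lemma braid_order s t k : s != t -> m s t = Some k -> (sg s * sg t) ^+ k = 1.
Proof.
move=> st mst; apply: (mulIg (wd (alt_word k t s))); rewrite mul1g -class_alt_word.
exact/class_of_wordP/WordEqRel/CoxeterBraid/ArtinRel.
Qed.

Lemma geo_walk_class u v : wd u = wd v ->
  walk (geo_step m) u =1 walk (geo_step m) v.
Proof.
move/class_of_wordP => uv f; apply: (walk_word_eq (P := fun=> True)) uv I => //.
  by move=> s b x _; apply: geo_stepK.
move=> u' v' g; case=> [_ _ [s t k st mst] _ | s _].
  rewrite walk_alt_word ?(geo_rot_order st) //; exact: geo_stepK.
exact: (geo_stepK m (s, true)).
Qed.

(** Run the word [(s t)^n] in the geometric representation. *)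
Lemma simple_refl_order s t n : s != t -> (0 < n)%N -> (sg s * sg t) ^+ n = 1 ->
  exists2 k, m s t = Some k & (k %| n)%N.
Proof.
move=> st n0 stn; apply: (geo_rot_faithful st n0) => f.
pose u k : word S := flatten (nseq k [:: (s, true); (t, true)]).
have wdu k : wd (u k) = (sg s * sg t) ^+ k.
  by elim: k => //= k IHk; rewrite !class_consE IHk expgS mulgA.
have walku k g : walk (geo_step m) (u k) g =
    iter k (geo_step m (t, true) \o geo_step m (s, true)) g.
  by elim: k g => // k IHk g; rewrite iterSr -IHk.
by rewrite -walku (geo_walk_class (v := [::])) // wdu.
Qed.

Lemma simple_refl_inj : injective sg.
Proof.
move=> s t st; apply/eqP/negP => /negP nst.
have [|k mst] := @simple_refl_order s t 1 nst isT.
  by rewrite expg1 st simple_refl2.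
by rewrite dvdn1 => /eqP k1; move: (coxeter_ge2 nst mst); rewrite k1.
Qed.

(** The finite entries of the matrix are the orders of the products of two
    simple reflections, and conjugation preserves the order. *)
Lemma coxeter_entry_conj s t x y w k : s != t -> x != y ->
  sg s ^ w = sg x -> sg t ^ w = sg y -> m s t = Some k -> m x y = Some k.
Proof.
move=> st xy sx ty mst.
have xyE n : (sg x * sg y) ^+ n = ((sg s * sg t) ^+ n) ^ w.
  by rewrite -sx -ty -conjMg conjXg.
have k0 : (0 < k)%N := ltnW (coxeter_ge2 st mst).
have [|l mxy lk] := simple_refl_order xy k0.
  by rewrite xyE (braid_order st) // conj1g.
have /eqP := xyE l; rewrite (braid_order xy mxy) eq_sym conjg_eq1 => /eqP stl.
have l0 : (0 < l)%N := ltnW (coxeter_ge2 xy mxy).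
have [k' + kl] := simple_refl_order st l0 stl.
rewrite mst => -[] kk'; rewrite -kk' in kl.
by rewrite mxy; congr Some; apply/eqP; rewrite eqn_dvd lk kl.
Qed.

(** ** Inversions *)

(** The reflections [s_1 ... s_(i-1) s_i s_(i-1) ... s_1] of the walls crossed
    by the gallery that the word describes from the base chamber. *)
Fixpoint refls (u : word S) : seq W :=
  if u is a :: u' then sg a.1 :: [seq r ^ sg a.1 | r <- refls u'] else [::].

Lemma count_conj (x t : W) (l : seq W) :
  count_mem t [seq r ^ x | r <- l] = count_mem (t ^ x^-1) l.
Proof.
rewrite count_map; apply: eq_count => r /=.
by rewrite (can2_eq (conjgK x) (conjgKV x)).
Qed.

Lemma count_refls_cons a u t :
  count_mem t (refls (a :: u)) =
    ((sg a.1 == t) + count_mem (t ^ sg a.1)%g (refls u))%N.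
Proof. by rewrite /= count_conj simple_reflV. Qed.

Lemma refls_alt_word k s t :
  refls (alt_word k s t) = mkseq (fun i => (sg s * sg t) ^+ i * sg s) k.
Proof.
elim: k s t => // k IHk s t; rewrite alt_wordS /= IHk /mkseq /= mul1g.
rewrite -[1%N]addn0 iotaDl -!map_comp; congr (_ :: _).
apply: eq_map => i /=; rewrite add1n.
have pull j : sg s * (sg t * sg s) ^+ j = (sg s * sg t) ^+ j * sg s.
  by elim: j => [|j IHj]; rewrite ?mulg1 ?mul1g // !expgS -!mulgA -IHj !mulgA.
by rewrite conjgE simple_reflV !mulgA pull expgSr -!mulgA.
Qed.

(** The two galleries around a wall intersection of codimension 2 cross the
    same walls in opposite orders. *)
Lemma refls_alt_word_rev k s t : s != t -> m s t = Some k ->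
  refls (alt_word k t s) = rev (refls (alt_word k s t)).
Proof.
move=> st mst; rewrite !refls_alt_word; set a := mkseq _ _; set b := mkseq _ _.
have sa : size a = k by rewrite size_mkseq.
have sb : size b = k by rewrite size_mkseq.
apply: (@eq_from_nth _ 1) => [|i]; rewrite ?size_rev ?sa ?sb // => ik.
rewrite nth_rev ?sb // !nth_mkseq ?subnSK ?leq_subr //.
  have -> : sg t * sg s = (sg s * sg t)^-1 by rewrite invgM !simple_reflV.
  have -> : (sg s * sg t)^-1 ^+ i = (sg s * sg t) ^+ (k - i.+1) * (sg s * sg t).
    rewrite -expgSr subnSK // expgnFr 1?ltnW // (braid_order st mst) mul1g.
    by rewrite expVgn.
  by rewrite -!mulgA simple_refl2 mulg1.
Qed.

(** The wall of [t] separates the base chamber from its image under [w]; by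
    [odd_count_refls], parities do not depend on the chosen word. *)
Definition inversion (w t : W) : bool := odd (count_mem t (refls (repr w))).

Lemma count_refls_cat u v t :
  count_mem t (refls (u ++ v)) =
    (count_mem t (refls u) + count_mem (t ^ wd u)%g (refls v))%N.
Proof.
elim: u t => [|a u IHu] t; first by rewrite class_nil conjg1.
by rewrite cat_cons !count_refls_cons IHu class_consE conjgM addnA.
Qed.

(** A cancelling pair of letters, like a square, crosses a single wall, twice;
    the two sides of a braid relation cross the same walls; concatenation is
    handled by the cocycle rule [count_refls_cat]. *)
Lemma odd_count_refls u v : wd u = wd v ->
  forall t, odd (count_mem t (refls u)) = odd (count_mem t (refls v)).
Proof.
have cancel2 s b b' t : odd (count_mem t (refls [:: (s, b); (s, b')])) = false.
  rewrite /= !addn0 /= (_ : sg s ^ sg s = sg s) ?oddD ?addbb //.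
  by rewrite conjgE simple_refl2 mulg1 simple_reflV.
move/class_of_wordP; elim=> {u v}.
- move=> _ _ [_ _ [s t k st mst]|s] x; last exact: cancel2.
  by rewrite (refls_alt_word_rev st mst) count_rev.
- by move=> s b t; apply: cancel2.
- by [].
- by move=> u v _ IH t; rewrite IH.
- by move=> u v w _ IHu _ IHv t; rewrite IHu.
- move=> u u' v v' uu' IHu vv' IHv t; rewrite !count_refls_cat !oddD IHu IHv.
  by have /class_of_wordP -> := uu'.
Qed.

Lemma inversion_class u t : inversion (wd u) t = odd (count_mem t (refls u)).
Proof. by apply: odd_count_refls; rewrite class_of_wordK. Qed.

Lemma inversion1 t : inversion 1 t = false.
Proof. exact: (inversion_class [::]). Qed.

Lemma inversionM v w t :
  inversion (v * w) t = inversion v t (+) inversion w (t ^ v).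
Proof.
rewrite -[v]class_of_wordK -[w]class_of_wordK -class_cat !inversion_class.
by rewrite count_refls_cat oddD.
Qed.

Lemma inversion_simple s t : inversion (sg s) t = (t == sg s).
Proof. by rewrite (inversion_class [:: (s, true)]) /= addn0 oddb eq_sym. Qed.

Lemma simple_refl_neq1 s : sg s != 1.
Proof.
by apply/eqP => s1; have := inversion_simple s (sg s); rewrite eqxx {1}s1 inversion1.
Qed.

Lemma conj_simple_refl s : sg s ^ sg s = sg s.
Proof. by rewrite conjgE simple_refl2 mulg1 simple_reflV. Qed.

(** ** Parabolic subgroups and reduced elements *)

Definition word_over (Y : {set S}) (u : word S) : bool :=
  all (fun a => a.1 \in Y) u.

Definition parabolic (Y : {set S}) (w : W) : Prop :=
  exists2 u, word_over Y u & w = wd u.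

Lemma parabolic1 Y : parabolic Y 1.
Proof. by exists [::]. Qed.

Lemma parabolicM Y v w : parabolic Y v -> parabolic Y w -> parabolic Y (v * w).
Proof.
move=> [u uY ->] [u' u'Y ->]; exists (u ++ u'); last by rewrite class_cat.
by rewrite /word_over all_cat; apply/andP.
Qed.

Lemma parabolic_simple (Y : {set S}) s : s \in Y -> parabolic Y (sg s).
Proof. by move=> sY; exists [:: (s, true)] => //=; rewrite /word_over /= sY. Qed.

Lemma parabolicV Y w : parabolic Y w -> parabolic Y w^-1.
Proof.
move=> [u uY ->]; elim: u uY => [_|a u IHu /andP[aY uY]].
  by rewrite invg1; apply: parabolic1.
rewrite class_consE invgM simple_reflV.
by apply: parabolicM; [apply: IHu | apply: parabolic_simple].
Qed.

Lemma parabolicMl Y v w : parabolic Y w -> parabolic Y (v * w) -> parabolic Y v.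
Proof. by move=> Yw Yvw; rewrite -[v](mulgK w); apply/parabolicM/parabolicV. Qed.

Lemma parabolicJ Y v w : parabolic Y w -> parabolic Y (v ^ w) <-> parabolic Y v.
Proof.
move=> Yw; split=> [Yvw|Yv]; last by do !apply: parabolicM => //; apply: parabolicV.
rewrite -[v](conjgK w) conjgE invgK.
by do !apply: parabolicM => //; apply: parabolicV.
Qed.

(** An inversion [t] occurs in the list of reflections of the word, and
    multiplying by the [i]-th one deletes the [i]-th letter. *)
Lemma strong_exchange Y u t : word_over Y u -> inversion (wd u) t ->
  exists u', [/\ word_over Y u', (size u' < size u)%N & wd u' = t * wd u].
Proof.
elim: u t => [t _|a u IHu t /andP[aY uY]]; first by rewrite inversion1.
rewrite class_consE inversionM inversion_simple.
case: eqP => [-> _|_ /= /(IHu _ uY)[u' [u'Y lt_u'u wdu']]].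
  by exists u; rewrite mulgA simple_refl2 mul1g.
exists (a :: u'); split=> //; first by rewrite /word_over /= aY.
by rewrite class_consE wdu' conjgE simple_reflV !mulgA simple_refl2 mul1g.
Qed.

Lemma inversion_parabolic Y w t : parabolic Y w -> inversion w t -> parabolic Y t.
Proof.
move=> Yw wt; case: (Yw) wt => u uY wE; rewrite wE.
move=> /(strong_exchange uY)[u' [u'Y _ u'E]].
by apply: (parabolicMl Yw); exists u'; rewrite ?wE.
Qed.

(** In a shortest word over [Y] the first letter is an inversion: otherwise
    strong exchange would shorten the word. *)
Lemma left_descent (Y : {set S}) w : parabolic Y w -> w != 1 ->
  exists2 s, s \in Y & inversion w (sg s).
Proof.
move=> [u]; have [n] := ubnP (size u); elim: n u => // n IHn [|a u] /=.
  by move=> _ _ ->; rewrite eqxx.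
rewrite ltnS => un /andP[aY uY] wE w1.
case wa: (inversion w (sg a.1)); first by exists a.1.
move: wa; rewrite {1}wE class_consE inversionM inversion_simple eqxx conj_simple_refl.
move/negbFE => /(strong_exchange uY)[u' [u'Y u'u u'E]].
by apply: (IHn u' (ltn_trans u'u un) u'Y); rewrite // wE u'E class_consE.
Qed.

(** [w] is the shortest element of the coset [W_Y w]. *)
Definition reduced (Y : {set S}) (w : W) : Prop :=
  forall t, parabolic Y t -> ~~ inversion w t.

Lemma reduced1 Y : reduced Y 1.
Proof. by move=> t _; rewrite inversion1. Qed.

Lemma reduced_exists Y w : exists2 y, parabolic Y y & reduced Y (y * w).
Proof.
have [u uS ->] : parabolic [set: S] w.
  by exists (repr w); [apply/allP => a; rewrite inE | rewrite class_of_wordK].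
have [n] := ubnP (size u); elim: n u uS => // n IHn u uS; rewrite ltnS => un.
have [Yu|/existsNP[t /not_implyP[Yt /negP]]] := pselect (reduced Y (wd u)).
  by exists 1; [apply: parabolic1 | rewrite mul1g].
rewrite negbK => /(strong_exchange uS)[u' [u'S u'u u'E]].
have [y Yy Yyu] := IHn u' u'S (leq_trans u'u un).
by exists (y * t); [apply: parabolicM | rewrite -mulgA -u'E].
Qed.

(** Deodhar's alternative.  Only the reflection [w s w^-1] can become an
    inversion in [W_Y] when [w] is multiplied by [s].  If it lies in [W_Y], it
    is its own only inversion there, and its left descent must then be itself,
    so that it is simple. *)
Lemma reduced_step (Y : {set S}) w s : reduced Y w ->
  (~ parabolic Y (sg s ^ w^-1) /\ reduced Y (w * sg s)) \/
  (exists2 x, x \in Y & sg x = sg s ^ w^-1).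
Proof.
move=> Yw; set r := sg s ^ w^-1.
have wsE t : parabolic Y t -> inversion (w * sg s) t = (t == r).
  move=> Yt; rewrite inversionM (negPf (Yw t Yt)) inversion_simple.
  by rewrite (can2_eq (conjgK w) (conjgKV w)).
have [Yr|Yr] := pselect (parabolic Y r); [right | left]; last first.
  by split=> // t Yt; rewrite wsE //; apply/eqP => tr; rewrite tr in Yt.
have r1 : r != 1 by rewrite conjg_eq1 simple_refl_neq1.
have [x xY rx] := left_descent Yr r1; exists x => //; apply/eqP.
rewrite -wsE; last exact: parabolic_simple.
rewrite (conjgCV w) -/r inversionM rx (negPf (Yw _ _)) //.
by apply/(parabolicJ _ Yr)/parabolic_simple.
Qed.

(** Kilmoyer's argument: if [p] lies in [W_D] and in [e W_Y e^-1], with [e]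
    shortest in [W_D e], then so do its left descents.  Indeed [p e = e u] with
    [u] in [W_Y]; the descent [s] is an inversion of the left side and not of
    [e], so [e^-1 s e] is an inversion of [u]. *)
Lemma descent_double_coset (Y D : {set S}) e p s : reduced D e -> parabolic D p ->
  s \in D -> inversion p (sg s) -> parabolic Y (p ^ e) -> parabolic Y (sg s ^ e).
Proof.
move=> De Dp sD ps Ype; apply: (inversion_parabolic Ype).
have := inversionM p e (sg s); rewrite ps (negPf (De _ _)); last first.
  by apply/(parabolicJ _ Dp)/parabolic_simple.
by rewrite conjgC inversionM (negPf (De _ _)) //; apply: parabolic_simple.
Qed.

(** If [t] is missing, stripping left descents off [p] can only remove [s], and
    only once. *)
Lemma dihedral_stabilizer (Y : {set S}) s t e :
  reduced [set s; t] e -> ~ parabolic Y (sg t ^ e) ->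
  forall p, parabolic [set s; t] p -> parabolic Y (p ^ e) -> p = 1 \/ p = sg s.
Proof.
move=> De tY p Dp Ype; have [->|p1] := eqVneq p 1; [by left | right].
have descent q : parabolic [set s; t] q -> parabolic Y (q ^ e) -> q != 1 ->
    inversion q (sg s) /\ parabolic Y (sg s ^ e).
  move=> Dq Yqe q1; have [z zD qz] := left_descent Dq q1.
  have Yz := descent_double_coset De Dq zD qz Yqe.
  by case/set2P: zD qz Yz => -> // _ /tY.
have [ps Ys] := descent p Dp Ype p1.
have sD : parabolic [set s; t] (sg s) by apply/parabolic_simple/set21.
have [sp1|sp1] := eqVneq (sg s * p) 1.
  by rewrite -[p](mulKg (sg s)) sp1 mulg1 simple_reflV.
have Yspe : parabolic Y ((sg s * p) ^ e) by rewrite conjMg; apply: parabolicM.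
have [] := descent (sg s * p) (parabolicM sD Dp) Yspe sp1.
by rewrite inversionM inversion_simple eqxx conj_simple_refl ps.
Qed.

End Coxeter.

(** * The action on labelled states *)

Section Retraction.
Variables (S : finType) (m : coxeter_matrix S) (Y : {set S}).
Local Notation A := (artin_group m).
Local Notation W := (coxeter_group m).
Local Notation wd := (class_of_word (coxeter_rel m)).
Local Notation cl := (class_of_word (artin_rel m)).
Local Notation sg := (simple_refl m).
Local Notation ag := (artin_gen m).

Lemma parabolic_conj_sub (D : {set S}) (e v : W) :
  (forall s, s \in D -> parabolic Y (sg s ^ e)) -> parabolic D v ->
  parabolic Y (v ^ e).
Proof.
move=> De [u uD ->]; elim: u uD => [_|a u IHu /andP[aD uD]].
  by rewrite class_nil conj1g; apply: parabolic1.
by rewrite class_consE conjMg; apply: parabolicM; [apply: De | apply: IHu].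
Qed.

(** At most one nontrivial element of [w W_D w^-1], namely [r], lies in [W_Y]. *)
Definition stabilizer_in (D : {set S}) (w r : W) : Prop :=
  forall v, parabolic D v -> parabolic Y (v ^ w^-1) -> v = 1 \/ v ^ w^-1 = r.

(** The part of [w W_D w^-1] in [W_Y], for [D] of rank 2, is everything or has
    order at most 2 (with [r = 1] standing for the trivial case): pass to the
    shortest element of the coset [W_D w^-1]. *)
Lemma dihedral_stabilizerP (s t : S) (w : W) :
  (parabolic Y (sg s ^ w^-1) /\ parabolic Y (sg t ^ w^-1)) \/
  (exists r, [/\ parabolic Y r, r * r = 1 & stabilizer_in [set s; t] w r]).
Proof.
have [y Dy] := reduced_exists [set s; t] w^-1; set e := y * _ => De.
have wE v : v ^ w^-1 = (v ^ y^-1) ^ e by rewrite -conjgM /e mulgA mulVg mul1g.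
have DyV v : parabolic [set s; t] v -> parabolic [set s; t] (v ^ y^-1).
  by move=> Dv; apply/parabolicJ => //; apply: parabolicV.
have one_missing z z' :
    [set z; z']%SET = [set s; t]%SET -> ~ parabolic Y (sg z' ^ e) ->
    exists r, [/\ parabolic Y r, r * r = 1 & stabilizer_in [set s; t] w r].
  move=> zz' nz'; rewrite -zz' in De DyV *.
  have stab := dihedral_stabilizer De nz'.
  have [Yz|nYz] := pselect (parabolic Y (sg z ^ e)).
    exists (sg z ^ e); split=> //; first by rewrite -conjMg simple_refl2 conj1g.
    move=> v Dv; rewrite wE => /(stab _ (DyV v Dv))[/eqP|->]; last by right.
    by rewrite conjg_eq1 => /eqP; left.
  exists 1; split; rewrite ?mul1g //; first exact: parabolic1.
  move=> v Dv; rewrite wE => Yv; case: (stab _ (DyV v Dv) Yv) => [/eqP|vz].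
    by rewrite conjg_eq1 => /eqP; left.
  by rewrite vz in Yv.
have [Ys|] := pselect (parabolic Y (sg s ^ e)); last first.
  by move=> nYs; right; apply: (one_missing t s) nYs; rewrite finset.setUC.
have [Yt|] := pselect (parabolic Y (sg t ^ e)); last first.
  by right; apply: (one_missing s t).
left; rewrite !wE; split; apply: (@parabolic_conj_sub [set s; t]).
1,3: by move=> z /set2P[] ->.
all: by apply/DyV/parabolic_simple; rewrite !inE eqxx ?orbT.
Qed.

Definition label (r : W) : option S := [pick x in Y | sg x == r].

Lemma labelP r x : label r = Some x -> x \in Y /\ sg x = r.
Proof. by rewrite /label; case: pickP => // z /andP[zY /eqP zr] [<-]. Qed.

Lemma label_simple x : x \in Y -> label (sg x) = Some x.
Proof.
move=> xY; rewrite /label; case: pickP => [z /andP[_ /eqP /simple_refl_inj -> //]|].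
by move/(_ x); rewrite xY eqxx.
Qed.

(** In a state [(a, w)] with [w] reduced, [w] represents the coset [W_Y w] and
    [a] is the product of the labels met so far.  A generator that moves the
    coset moves [w]; one that fixes it satisfies [w s = x w] with [x] in [Y],
    and its label is the generator [x] of the Artin group, inverted for an
    inverse letter. *)
Definition state_step (a : S * bool) (p : A * W) : A * W :=
  if label (sg a.1 ^ p.2^-1) is Some x then (p.1 * cl [:: (x, a.2)], p.2)
  else (p.1, p.2 * sg a.1).

Lemma label_reduced w s : reduced Y w -> parabolic Y (sg s ^ w^-1) ->
  exists2 x, label (sg s ^ w^-1) = Some x & x \in Y.
Proof.
move=> Yw Ys; have [[] //|[x xY <-]] := reduced_step s Yw.
by exists x => //; apply: label_simple.
Qed.

Lemma label_None w s : ~ parabolic Y (sg s ^ w^-1) -> label (sg s ^ w^-1) = None.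
Proof.
move=> nYs; case E: label => [x|//]; have [xY xs] := labelP E.
by case: nYs; rewrite -xs; apply: parabolic_simple.
Qed.

Lemma state_step_reduced a p : reduced Y p.2 -> reduced Y (state_step a p).2.
Proof.
move=> Yw; rewrite /state_step; case E: label => [x|] //=.
have [[] //|[x xY xE]] := reduced_step a.1 Yw.
by rewrite -xE label_simple in E.
Qed.

Lemma state_stepK s b p : state_step (s, ~~ b) (state_step (s, b) p) = p.
Proof.
case: p => a w; rewrite /state_step /=; case E: (label (sg s ^ w^-1)) => [x|] /=.
  rewrite E -mulgA -class_cat; congr (_, _).
  have /class_of_wordP -> := WordEqCancel (artin_rel m) x b.
  by rewrite class_nil mulg1.
rewrite invgM conjgM simple_reflV conj_simple_refl E.
by rewrite -mulgA simple_refl2 mulg1.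
Qed.

(** The outcome depends on the word only through its value and the number of
    times its gallery from [w] crosses the wall of [r], which are the same for both sides of a
    braid relation. *)
Lemma state_walk_single (D : {set S}) (r : W) u a w c :
  parabolic Y r -> r * r = 1 -> word_over D u -> all snd u ->
  reduced Y w -> stabilizer_in D w r -> c = count_mem (r ^ w) (refls m u) ->
  walk state_step u (a, w) =
    (a * (if label r is Some x then ag x else 1) ^+ c, r ^+ c * w * wd u).
Proof.
move=> Yr r2; set b := (if _ is Some x then _ else _).
elim: u a w c => [|[s e] u IHu] a w c.
  by move=> _ _ _ _ ->; rewrite /= mulg1 mul1g mulg1.
move=> /andP[sD uD] /andP[eT uT] Yw Dw.
have {}sD : s \in D := sD; have {e eT} -> : e = true := eT.
rewrite count_refls_cons class_consE /state_step /= => ->.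
have Ds : parabolic D (sg s) by apply: parabolic_simple.
have [Ys|nYs] := pselect (parabolic Y (sg s ^ w^-1)).
  have sr : sg s ^ w^-1 = r.
    by case: (Dw _ Ds Ys) => // s1; move/eqP: (simple_refl_neq1 m s).
  have [x xE xY] := label_reduced Yw Ys; rewrite xE (IHu _ _ _ uD uT Yw Dw erefl).
  have bE : b = ag x by rewrite /b -sr xE.
  have rw : r ^ w = sg s by rewrite -sr conjgKV.
  rewrite rw conj_simple_refl eqxx add1n !expgS bE; congr (_, _).
    by rewrite mulgA.
  have wr : r * w = w * sg s by rewrite conjgC rw.
  rewrite -expgS expgSr -!mulgA; congr (_ * _).
  rewrite [r * (w * _)]mulgA wr -mulgA.
  by rewrite [sg s * (sg s * _)]mulgA simple_refl2 mul1g.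
rewrite label_None // (IHu _ _ _ uD uT _ _ erefl).
- rewrite conjgM; case: eqP => [srw|_]; last by rewrite add0n !mulgA.
  by case: nYs; rewrite srw conjgK.
- case: (reduced_step s Yw) => [[]//|[x xY xE]].
  by case: nYs; rewrite -xE; apply: parabolic_simple.
move=> v Dv; rewrite invgM conjgM simple_reflV => Yv.
case: (Dw (v ^ sg s) _ Yv) => [|/eqP|]; [by apply/parabolicJ| |by right].
by rewrite conjg_eq1 => /eqP; left.
Qed.

(** When both generators fix the coset, their labels spell the corresponding
    alternating word. *)
Lemma state_walk_fixed k s t x y a w :
  label (sg s ^ w^-1) = Some x -> label (sg t ^ w^-1) = Some y ->
  walk state_step (alt_word k s t) (a, w) = (a * cl (alt_word k x y), w).
Proof.
elim: k s t x y a => [|k IHk] s t x y a sx ty; first by rewrite /= mulg1.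
rewrite !alt_wordS class_cons /= {2}/state_step /= sx (IHk _ _ _ _ _ ty sx).
by rewrite mulgA.
Qed.

Lemma alt_word_over k (s t : S) : word_over [set s; t] (alt_word k s t).
Proof.
by apply/allP => _ /mapP[i _ ->] /=; case: (odd i); rewrite !inE eqxx ?orbT.
Qed.

Lemma alt_word_pos k (s t : S) : all snd (alt_word k s t).
Proof. by apply/allP => _ /mapP[i _ ->]. Qed.

Lemma state_walk_braid s t k p : s != t -> m s t = Some k -> reduced Y p.2 ->
  walk state_step (alt_word k s t) p = walk state_step (alt_word k t s) p.
Proof.
case: p => a w st mst /= Yw.
have wdE : wd (alt_word k s t) = wd (alt_word k t s).
  exact/class_of_wordP/WordEqRel/CoxeterBraid/ArtinRel.
have [[Ys Yt]|[r [Yr r2 Dw]]] := dihedral_stabilizerP s t w.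
  have [x xs _] := label_reduced Yw Ys; have [y yt _] := label_reduced Yw Yt.
  rewrite (state_walk_fixed _ _ xs yt) (state_walk_fixed _ _ yt xs); congr (_ * _, _).
  have [_ xE] := labelP xs; have [_ yE] := labelP yt.
  have xy : x != y.
    apply: contra_neq st => xy; apply: (@simple_refl_inj _ m).
    by apply: (conjg_inj w^-1); rewrite -xE -yE xy.
  apply/class_of_wordP/WordEqRel/ArtinRel => //.
  exact: (coxeter_entry_conj st xy (esym xE) (esym yE) mst).
have oU := alt_word_over k t s; rewrite finset.setUC in oU.
have st_pos := alt_word_pos k s t; have ts_pos := alt_word_pos k t s.
rewrite (state_walk_single a Yr r2 (alt_word_over k s t) st_pos Yw Dw erefl).
rewrite (state_walk_single a Yr r2 oU ts_pos Yw Dw erefl).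
by rewrite wdE (refls_alt_word_rev st mst) count_rev.
Qed.

Lemma state_walk_class u v p : reduced Y p.2 -> cl u = cl v ->
  walk state_step u p = walk state_step v p.
Proof.
move=> Yp /class_of_wordP uv.
apply: (walk_word_eq (P := fun p => reduced Y p.2)) uv Yp.
- exact: state_step_reduced.
- by move=> s b q _; apply: state_stepK.
- by move=> _ _ q [s t k st mst] Yq; apply: state_walk_braid.
Qed.

Definition act (p : A * W) (h : A) : A * W := walk state_step (repr h) p.

Lemma act_class p u : reduced Y p.2 -> act p (cl u) = walk state_step u p.
Proof. by move=> Yp; apply: state_walk_class => //; rewrite class_of_wordK. Qed.

Lemma act_reduced p h : reduced Y p.2 -> reduced Y (act p h).2.
Proof.
exact: (walk_inv (P := fun p : A * W => reduced Y p.2) state_step_reduced).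
Qed.

Lemma actM p h k : reduced Y p.2 -> act p (h * k) = act (act p h) k.
Proof.
move=> Yp; rewrite -[h]class_of_wordK -[k]class_of_wordK -class_cat.
by rewrite !act_class ?walk_cat //; apply: act_reduced.
Qed.

Lemma act1 p : reduced Y p.2 -> act p 1 = p.
Proof. exact: (act_class [::]). Qed.

Lemma act_gen p s : reduced Y p.2 -> act p (ag s) = state_step (s, true) p.
Proof. exact: (act_class [:: (s, true)]). Qed.

(** The labels do not depend on the left factor. *)
Lemma act_mull c a w h :
  act (c * a, w) h = (c * (act (a, w) h).1, (act (a, w) h).2).
Proof.
rewrite /act; move: (repr h) => u; elim: u a w => //= l u IHu a w.
by rewrite /state_step /=; case: label => [x|] /=; rewrite -?mulgA IHu.
Qed.

End Retraction.

(** * Conjugates of generators inside a standard parabolic subgroup *)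

Section Parabolic.
Variables (S : finType) (m : coxeter_matrix S) (Y : {set S}).
Local Notation A := (artin_group m).
Local Notation sg := (simple_refl m).
Local Notation ag := (artin_gen m).
Local Notation AY := (std_parabolic m Y).
Local Notation act := (act (m := m) Y).

Lemma std_parabolic_gen s : s \in Y -> AY (ag s).
Proof. by move=> sY; apply: sub_generated; exists s. Qed.

(** The base coset is fixed by every generator of [A_Y], each its own label. *)
Lemma act_std_parabolic h : AY h -> forall a, act (a, 1) h = (a * h, 1).
Proof.
have Y1 := @reduced1 S m Y.
apply: (@generated_min A _ [set h | forall a, act (a, 1) h = (a * h, 1)]).
  split=> [a|k l Hk Hl a|k Hk a] /=.
  - by rewrite act1 ?mulg1.
  - by rewrite actM // Hk Hl mulgA.
  rewrite -[a in LHS](mulgVK k) -Hk -actM // mulgV.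
  by rewrite act1.
move=> _ [s sY <-] a; rewrite act_gen // /state_step /= invg1 conjg1.
by rewrite label_simple.
Qed.

Lemma act_fst_parabolic p h : AY p.1 -> AY (act p h).1.
Proof.
have [_ AYM AYV] := generated_is_subgroup (@artin_gen S m @` [set` Y]).
apply: (walk_inv (P := fun p => AY p.1)) => {p h} a p AYp.
rewrite /state_step; case E: label => [x|] //=; apply: AYM => //.
have [xY _] := labelP E; rewrite class_letter.
by case: a.2; [|apply: AYV]; apply: std_parabolic_gen.
Qed.

(** Let [h = g s g^-1] and let [g] lead from [(1, 1)] to [(b, w)].  Then
    [h g = g s] leads to [(h b, w)] when read as [h] and then [g], and to the
    image of [(b, w)] under [s] when read as [g] and then [s].  Since the two
    have the same [w], the second step is labelled, by [x] say, and
    [h b = b x]. *)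
Lemma retraction_conj g s (p := act (1, 1) g) :
  AY (g * ag s * g^-1) ->
  exists2 x, x \in Y & g * ag s * g^-1 = p.1 * ag x * p.1^-1.
Proof.
set h := g * _ * _ => Yh; have Y1 := @reduced1 S m Y.
have hg : h * g = g * ag s by rewrite mulgVK.
have := actM g (ag s) (p := (1, 1)) Y1; rewrite -hg actM //.
rewrite act_std_parabolic // mul1g.
rewrite -[h in (h, _)]mulg1 act_mull -/p act_gen; last exact: act_reduced.
rewrite /state_step /=; case E: label => [x|] [].
  by move=> hx; exists x; [case: (labelP E) | rewrite -hx mulgK].
move=> _ /eqP; rewrite -[X in X == _]mulg1 (inj_eq (mulgI _)) eq_sym.
by rewrite (negPf (simple_refl_neq1 m s)).
Qed.

End Parabolic.

Theorem mainTheorem2 (S : finType) (m : coxeter_matrix S) (hm : spherical m)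
    (g : artin_group m) (X Y : {set S}) :
  conj_set g (std_parabolic m X) `<=` std_parabolic m Y ->
  exists R : {set S}, R \subset Y /\
    exists y : artin_group m, std_parabolic m Y y /\
      conj_set g (std_parabolic m X) = conj_set y (std_parabolic m R).
Proof.
move=> gXY; pose y := (act Y (1, 1) g).1.
pose images s : set S :=
  [set x | x \in Y /\ g * artin_gen m s * g^-1 = y * artin_gen m x * y^-1].
pose f s := xget s (images s).
have fP s : s \in X -> images s (f s).
  move=> sX; apply: xgetPex.
  have [|x xY xE] := @retraction_conj S m Y g s; last by exists x.
  by apply: gXY; exists (artin_gen m s) => //; apply: std_parabolic_gen.
exists [set f s | s in X]%SET; split.
  by apply/fintype.subsetP => _ /imsetP[s sX ->]; case: (fP s sX).
exists y; split.
  apply: act_fst_parabolic.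
  by have [] := generated_is_subgroup (@artin_gen S m @` [set` Y]).
apply: conj_generated_eq; apply/seteqP; split=> _ [_ [s sX <-] <-].
  exists (artin_gen m (f s)); last by case: (fP s sX).
  by exists (f s) => //; apply/imsetP; exists s.
have /imsetP[z zX ->] := sX; exists (artin_gen m z); last by case: (fP z zX).
by exists z.
Qed.
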